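(* Let $F$ be any field, $m$ and $n$ positive integers, and $R$ an $F$-subalgebra of the matrix algebra $\mathbb{M}_n(F)$ with Lie nilpotence index $m$. Then $$\dim_F R\leqslant M(m+1,n).$$
   Context: All rings are associative with identity, and subalgebras contain the identity. $\mathbb{M}_n(F)$ is the $F$-algebra of $n\times n$ matrices over $F$. In a ring $R$ put $[r,s]=rs-sr$, $[x_1]^*=x_1$ and $[x_1,\ldots,x_k]^*=[[x_1,\ldots,x_{k-1}]^*,x_k]$ for $k>1$. $R$ is Lie nilpotent of index $m$ (has Lie nilpotence index $m$) if $[x_1,x_2,\ldots,x_{m+1}]^*=0$ for all $x_1,\ldots,x_{m+1}\in R$ (minimality of $m$ is not required). For positive integers $\ell,n$, $$M(\ell,n)=\max\Big\{\tfrac12\Big(n^2-\sum_{i=1}^{\ell}k_i^2\Big)+1 : k_1,\ldots,k_\ell \text{ nonnegative integers with } \sum_{i=1}^{\ell}k_i=n\Big\}.$$ *)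

(* Defs.v *)
From HB Require Import structures.
From mathcomp Require Import all_boot all_order all_algebra.

Set Implicit Arguments.
Unset Strict Implicit.
Unset Printing Implicit Defensive.

Import GRing.Theory.
Local Open Scope ring_scope.

Definition lie_bracket (A : pzRingType) (r s : A) : A := r * s - s * r.

(* [x, y_1, ..., y_k]^* is [lie_comm x [:: y_1; ...; y_k]]. *)
Definition lie_comm (A : pzRingType) (x : A) (ys : seq A) : A :=
  foldl (@lie_bracket A) x ys.

(* Minimality of [m] is not required. *)
Definition lie_nilpotent_index (A : pzRingType) (S : {pred A}) (m : nat) : Prop :=
  forall (x : A) (ys : m.-tuple A),
    x \in S -> {in ys, forall y, y \in S} -> lie_comm x ys = 0.

(* An [{aspace _}] may have an identity element other than that of the ambient
   algebra, and needs a dimension of the form [n.+1]; hence this predicate. *)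
Definition is_subalgebra (F : fieldType) (n : nat) (R : {vspace 'M[F]_n}) : Prop :=
  1%:M \in R /\ {in R &, forall A B, A *m B \in R}.

(* Natural-number subtraction and halving are exact here: if the k_i sum to n
   then \sum_i k_i ^ 2 <= n ^ 2, and both sides have the parity of n.  Each k_i
   is at most n, so nothing is lost by taking it in 'I_n.+1.  For l > 0 the
   range of the maximum is nonempty. *)
Definition M (l n : nat) : nat :=
  (\max_(k : {ffun 'I_l -> 'I_n.+1} | \sum_(i < l) k i == n)
     ((n ^ 2 - \sum_(i < l) k i ^ 2)./2 + 1))%N.

(* Main.v *)
Require Import Defs.
From HB Require Import structures.
From mathcomp Require Import all_boot all_order all_algebra.
From mathcomp Require Import zify.
From Stdlib Require Import Classical.

Set Implicit Arguments.
Unset Strict Implicit.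
Unset Printing Implicit Defensive.

Import GRing.Theory.
Local Open Scope ring_scope.

(** Let R act on row vectors from the right. If R contains an idempotent f other
    than 0 and 1, then f is central by Lie nilpotency, so R splits into corners
    and induction applies since M is superadditive. Otherwise, by Fitting's lemma,
    R is local and its radical J is the set of its nilpotent elements.

    For R local of residue degree d acting faithfully on U, let w_1, ..., w_k be a
    minimal family of generators of U, so that dim U = dim UJ + k d, and let K be
    the annihilator of the w_i in J. Then dim J <= k dim UJ + dim K. A bracket z of
    m elements of K kills the w_i and commutes with R, hence kills
    U = \sum_i w_i R: so K has Lie nilpotence index m - 1. Since K acts faithfully
    on a complement Y of <w_1, ..., w_k> that contains UJ, and dim Y = dim U - k,
    the nil algebra K is bounded in the same way (with d = 1), by induction on m.
    The successive values of k are the parts k_i. *)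

(** * Compositions and the bound [M] *)

(* The second elementary symmetric function \sum_(i < j) k_i * k_j. *)
Fixpoint esum2 (s : seq nat) : nat :=
  if s is k :: s' then (k * sumn s' + esum2 s')%N else 0%N.

(** Subtraction-free link between [esum2] and the halved difference maximised in [M]. *)
Lemma esum2_sumsq (s : seq nat) :
  ((sumn s) ^ 2 = esum2 s * 2 + sumn [seq k ^ 2 | k <- s])%N.
Proof.
elim: s => //= k s IH.
rewrite sqrnD IH; move: (sumn s) (esum2 s) (sumn _) => a b c; lia.
Qed.

Lemma esum2_nseq0 (l : nat) : esum2 (nseq l 0%N) = 0%N.
Proof. by elim: l => //= l ->. Qed.

Lemma esum2_sumn0 (s : seq nat) : sumn s = 0%N -> esum2 s = 0%N.
Proof.
elim: s => //= k s IH /eqP; rewrite addn_eq0 => /andP[/eqP -> /eqP h].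
by rewrite IH.
Qed.

(* The second alternative holds when both compositions are supported at the
   same single index. *)
Lemma esum2_add (s t : seq nat) : size s = size t ->
  exists r : seq nat, [/\ size r = size s, sumn r = (sumn s + sumn t)%N,
    (esum2 s + esum2 t <= esum2 r)%N &
    [|| (esum2 s + esum2 t < esum2 r)%N, (esum2 s + esum2 t == 0)%N,
        sumn s == 0%N | sumn t == 0%N] ].
Proof.
elim: s t => [|a s IH] [|b t] //=; first by exists [::].
(* Termwise addition gains the cross terms [a * sumn t + b * sumn s]. *)
case=> /IH[r [r1 r2 r3 r4]]; exists ((a + b)%N :: r).
split; rewrite /= ?r1 ?r2 //; [lia|nia|].
have hs := @esum2_sumn0 s; have ht := @esum2_sumn0 t.
move: hs ht r3 r4; move: (esum2 r) (esum2 s) (esum2 t) (sumn s) (sumn t).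
move=> x y z u v hs ht r3 r4.
have [u0|u0] := posnP u; have [v0|v0] := posnP v;
  have [a0|a0] := posnP a; have [b0|b0] := posnP b;
  subst; rewrite ?(hs erefl) ?(ht erefl) in r3 r4 *; try nia.
Qed.

(** The strict gain absorbs one of the two [+ 1] when the bounds for two summands are added. At
    least two parts are required: with a single part [esum2] is always 0. *)
Lemma esum2_superadd (l : nat) (s t : seq nat) :
  size s = l.+2 -> size t = l.+2 -> (0 < sumn s)%N -> (0 < sumn t)%N ->
  exists r : seq nat, [/\ size r = l.+2, sumn r = (sumn s + sumn t)%N &
    (esum2 s + esum2 t < esum2 r)%N].
Proof.
move=> ss st s0 t0; have [|r [r1 r2 r3]] := @esum2_add s t; first by rewrite ss.
case/or4P => [h|/eqP h|h|h]; [by exists r; rewrite r1 | | lia | lia].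
(* Both values are 0 here, while this composition has value [(sumn s + sumn t).-1], which is
   positive because both sums are. *)
exists [:: 1%N, (sumn s + sumn t).-1 & nseq l 0%N].
by rewrite /= size_nseq sumn_nseq esum2_nseq0; split => //; lia.
Qed.

Lemma esum2_le_M (s : seq nat) : (esum2 s + 1 <= M (size s) (sumn s))%N.
Proof.
set l := size s; set n := sumn s.
have sn (i : 'I_l) : (nth 0 s i < n.+1)%N.
  rewrite ltnS /n sumnE (big_nth 0%N) big_mkord (bigD1 i) //=.
  exact: leq_addr.
pose k : {ffun 'I_l -> 'I_n.+1} := [ffun i => Ordinal (sn i)].
rewrite /M; apply: (leq_trans _ (leq_bigmax_cond k _)) => /=.
- rewrite leq_add2r (esum2_sumsq s).
  have -> : (\sum_(i < l) k i ^ 2 = sumn [seq k ^ 2 | k <- s])%N.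
    rewrite sumnE big_map (big_nth 0%N) big_mkord.
    by apply: eq_bigr => i _; rewrite ffunE.
  by rewrite addnK muln2 doubleK.
- have nE : n = (\sum_(i < l) nth 0 s i)%N.
    by rewrite /n sumnE (big_nth 0%N) big_mkord.
  by apply/eqP; rewrite [RHS]nE; apply: eq_bigr => i _; rewrite ffunE.
Qed.

(** * Powers of a subspace, and subspaces defined by a predicate *)

Section VectorSpaces.
Variables (F : fieldType) (vT : vectType F).

Definition ffun_comb (k : nat) (V : {vspace vT}) (A : 'M[F]_(k, \dim V)) :
    {ffun 'I_k -> vT} :=
  [ffun i => \sum_(j < \dim V) A i j *: (vbasis V)`_j].

Lemma ffun_comb_is_linear k V : linear (@ffun_comb k V).
Proof.
move=> c A B; apply/ffunP => i; rewrite !ffunE scaler_sumr -big_split /=.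
by apply: eq_bigr => j _; rewrite !mxE scalerDl scalerA.
Qed.

HB.instance Definition _ k V :=
  GRing.isLinear.Build F _ _ _ (@ffun_comb k V) (@ffun_comb_is_linear k V).

(** The [k]-th power of [V], built as an image of coordinate matrices so that its dimension follows
    from injectivity. *)
Definition ffun_vspace (k : nat) (V : {vspace vT}) :
    {vspace {ffun 'I_k -> vT}} :=
  limg (linfun (@ffun_comb k V)).

Lemma ffun_vspaceP (k : nat) (V : {vspace vT}) (f : {ffun 'I_k -> vT}) :
  reflect (forall i, f i \in V) (f \in ffun_vspace k V).
Proof.
apply: (iffP memv_imgP) => [[A _ ->] i|fV].
  rewrite lfunE ffunE; apply: memv_suml => j _; apply: memvZ.
  by apply: vbasis_mem; rewrite mem_nth // size_tuple.
exists (\matrix_(i, j) coord (vbasis V) j (f i)); first exact: memvf.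
apply/ffunP => i; rewrite lfunE ffunE {1}(coord_vbasis (fV i)).
by apply: eq_bigr => j _; rewrite mxE.
Qed.

Lemma dim_ffun_vspace (k : nat) (V : {vspace vT}) : \dim (ffun_vspace k V) = (k * \dim V)%N.
Proof.
rewrite limg_dim_eq ?dimvf //; apply/eqP; rewrite -subv0; apply/subvP => A.
rewrite memv_cap memv_ker memv0 => /andP[_]; rewrite lfunE => /eqP A0.
have /freeP fr := basis_free (vbasisP V).
apply/eqP/matrixP => i j; rewrite mxE; apply: (fr (A i)).
by have /ffunP/(_ i) := A0; rewrite !ffunE.
Qed.

(** Classically, if no subspace inside [P] exhausted [P], each could be enlarged by a line and
    dimensions would be unbounded. This later turns the set of nilpotent elements into a
    subspace. *)
Lemma vspace_of_pred (P : vT -> Prop) :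
  P 0 -> (forall c u v, P u -> P v -> P (c *: u + v)) ->
  exists V : {vspace vT}, forall v, v \in V <-> P v.
Proof.
move=> P0 PL.
suff [V VP Vmax] : exists2 V : {vspace vT}, (forall v, v \in V -> P v) &
    forall v, P v -> v \in V.
  by exists V => v; split; [apply: VP | apply: Vmax].
apply: NNPP => noV.
suff /(_ (\dim {: vT}).+1)[V VP] : forall d, exists2 V : {vspace vT},
    (forall v, v \in V -> P v) & (d <= \dim V)%N.
  by rewrite ltnNge dimvS // subvf.
elim=> [|d [V VP dV]]; first by exists 0%VS => // v; rewrite memv0 => /eqP ->.
have [v Pv vV] : exists2 v, P v & v \notin V.
  apply: NNPP => nv; apply: noV; exists V => // v Pv.
  by apply/negPn/negP => vV; apply: nv; exists v.
exists (<[v]> + V)%VS.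
  by move=> _ /memv_addP[_ /vlineP[c ->] [w wV ->]]; apply: PL => //; apply: VP.
rewrite dimv_disjoint_sum ?dim_vline; last first.
  apply/eqP; rewrite -subv0; apply/subvP => _ /memv_capP[/vlineP[c ->]].
  have [->|c0] := eqVneq c 0; first by rewrite scale0r !mem0v.
  by rewrite rpredZeq (negPf c0) (negPf vV).
by have -> : v != 0 by apply: contraNneq vV => ->; rewrite mem0v.
Qed.

End VectorSpaces.

(** * Algebras acting on row vectors: minimal generating families *)

Section LocalAlgebra.
Variables (F : fieldType) (n : nat).
Implicit Types (U Y : {vspace 'rV[F]_n.+1}) (R J K : {vspace 'M[F]_n.+1}).
Implicit Types (e a b r : 'M[F]_n.+1).

Definition mul_closed R := {in R &, forall a b, a * b \in R}.

Definition acts_on R U := forall u a, u \in U -> a \in R -> u *m a \in U.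

Definition faithful_on R U :=
  forall a, a \in R -> (forall u, u \in U -> u *m a = 0) -> a = 0.

Definition gen_comb (k : nat) (w : 'I_k -> 'rV[F]_n.+1)
    (r : {ffun 'I_k -> 'M[F]_n.+1}) : 'rV[F]_n.+1 :=
  \sum_i w i *m r i.

Lemma gen_comb_is_linear k w : linear (@gen_comb k w).
Proof.
move=> c r s; rewrite /gen_comb scaler_sumr -big_split /=.
by apply: eq_bigr => i _; rewrite !ffunE mulmxDr scalemxAr.
Qed.

HB.instance Definition _ k w :=
  GRing.isLinear.Build F _ _ _ (@gen_comb k w) (@gen_comb_is_linear k w).

(** The kernel of this map is the annihilator of the family [w]. *)
Definition gen_images (k : nat) (w : 'I_k -> 'rV[F]_n.+1) (a : 'M[F]_n.+1) :
    {ffun 'I_k -> 'rV[F]_n.+1} :=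
  [ffun i => w i *m a].

Lemma gen_images_is_linear k w : linear (@gen_images k w).
Proof.
by move=> c a b; apply/ffunP => i; rewrite !ffunE mulmxDr scalemxAr.
Qed.

HB.instance Definition _ k w :=
  GRing.isLinear.Build F _ _ _ (@gen_images k w) (@gen_images_is_linear k w).

Definition generated R U (k : nat) (w : 'I_k -> 'rV[F]_n.+1) : Prop :=
  (forall i, w i \in U) /\
  forall u, u \in U ->
    exists2 r : {ffun 'I_k -> 'M[F]_n.+1}, (forall i, r i \in R) & u = gen_comb w r.

(** A basis of [U] generates, with coefficients [c *: e], since [e] acts as the identity on [U];
    descent on the number of generators does the rest. *)
Lemma min_generated R U e : e \in R -> (forall u, u \in U -> u *m e = u) ->
  exists k (w : 'I_k -> 'rV[F]_n.+1), generated R U w /\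
    forall j (v : 'I_j -> 'rV[F]_n.+1), generated R U v -> (k <= j)%N.
Proof.
move=> eR eU; suff H k (w : 'I_k -> 'rV[F]_n.+1) : generated R U w ->
  exists k (w : 'I_k -> 'rV[F]_n.+1), generated R U w /\
    forall j (v : 'I_j -> 'rV[F]_n.+1), generated R U v -> (k <= j)%N.
  apply: (H (\dim U) (fun i => (vbasis U)`_i)); split=> [i|u uU].
    by apply: vbasis_mem; rewrite mem_nth // size_tuple.
  exists [ffun i => coord (vbasis U) i u *: e].
    by move=> i; rewrite ffunE memvZ.
  rewrite /gen_comb -{1}(eU u uU) {1}(coord_vbasis uU) mulmx_suml.
  by apply: eq_bigr => i _; rewrite ffunE -scalemxAl scalemxAr.
elim/ltn_ind: k w => k IH w gw; apply: NNPP => nex.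
apply: (nex); exists k, w; split=> // j v gv; rewrite leqNgt; apply/negP => jk.
exact: nex (IH j jk v gv).
Qed.

(* The Nakayama-type step: a relation with a coefficient outside J, hence
   invertible, would make one of the generators superfluous. *)
Lemma min_generated_free R U J e k (w : 'I_k -> 'rV[F]_n.+1)
    (s : {ffun 'I_k -> 'M[F]_n.+1}) :
  mul_closed R -> acts_on R U -> (forall u, u \in U -> u *m e = u) ->
  (forall r, r \in R -> r \notin J -> exists2 t, t \in R & r * t = e) ->
  generated R U w ->
  (forall j (v : 'I_j -> 'rV[F]_n.+1), generated R U v -> (k <= j)%N) ->
  (forall i, s i \in R) -> gen_comb w s = 0 -> forall i, s i \in J.
Proof.
move=> mR RU eU inv [wU wg] wmin sR s0 i; apply/negPn/negP => /(inv _ (sR i))[t tR st].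
case: k i w s wU wg wmin sR s0 st => [[] //|k] i w s wU wg wmin sR s0 st.
have /wmin : generated R U (fun j => w (lift i j)); last by rewrite ltnn.
split=> // u /wg[r rR ->].
(* These coefficients come from eliminating [w i]: multiplying the relation by the inverse [t] of
   [s i] expresses [w i] through the other generators. *)
exists [ffun j => r (lift i j) - s (lift i j) * (t * r i)].
  by move=> j; rewrite ffunE memvB ?mR.
have wi : w i = - \sum_j w (lift i j) *m (s (lift i j) * t).
  rewrite -{1}(eU _ (wU i)) -st mulmxA.
  have -> : w i *m s i = - \sum_j w (lift i j) *m s (lift i j).
    by apply/eqP; move/eqP: s0; rewrite /gen_comb (bigD1_ord i) //= addr_eq0.
  rewrite mulNmx mulmx_suml; congr (- _).
  by apply: eq_bigr => j _; rewrite mulmxA.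
rewrite /gen_comb (bigD1_ord i) //= wi mulNmx mulmx_suml addrC -sumrB.
apply: eq_bigr => j _; rewrite ffunE mulmxBr mulrA; congr (_ - _).
exact: esym (mulmxA _ _ _).
Qed.

(** * The inductive step: splitting off one part *)

Lemma lie_comm_mem R (x : 'M[F]_n.+1) (ys : seq 'M[F]_n.+1) :
  mul_closed R -> x \in R -> {in ys, forall y, y \in R} ->
  lie_comm x ys \in R.
Proof.
move=> mR; elim: ys x => //= y ys IH x xR yR.
have yR0 : y \in R by apply: yR; rewrite mem_head.
apply: IH => [|z zs]; last by apply: yR; rewrite inE zs orbT.
by rewrite /lie_bracket memvB ?mR.
Qed.

(** Stated so as to cover both a local algebra with radical [J] and a nil algebra [J] with a unit
    adjoined. The difference [\dim R - \dim J] is the residue degree, and [x] will be the dimension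
    of [U J]. *)
Lemma local_step R J U e m :
  e \in R -> (forall u, u \in U -> u *m e = u) -> mul_closed R -> acts_on R U ->
  (J <= R)%VS -> (forall r a, r \in R -> a \in J -> r * a \in J) -> e \notin J ->
  (forall r, r \in R -> r \notin J -> exists2 t, t \in R & r * t = e) ->
  faithful_on J U ->
  (forall (x : 'M[F]_n.+1) (ys : m.-tuple 'M[F]_n.+1) r,
     x \in J -> {in ys, forall y, y \in J} -> r \in R ->
     lie_bracket (lie_comm x ys) r = 0) ->
  exists k x Y K, [/\ (\dim U = x + k * (\dim R - \dim J))%N /\
       (0 < \dim U -> 0 < k)%N,
     (\dim Y + k = \dim U)%N, (\dim J <= k * x + \dim K)%N &
     [/\ (K <= J)%VS, mul_closed K, acts_on K Y, faithful_on K Y &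
       lie_nilpotent_index K m]].
Proof.
move=> eR eU mR RU JR RJ eJ inv fJ lJ.
have [k [w [gw wmin]]] := min_generated eR eU.
have wfree := min_generated_free mR RU eU inv gw wmin.
have [wU wg] := gw.
pose Phi := linfun (@gen_comb k w); pose Psi := linfun (@gen_images k w).
pose Rk := ffun_vspace k R; pose Jk := ffun_vspace k J.
(* [X] is [U J], [K] is the annihilator of the generators in [J], and [Y] will be a complement of
   [W] in [U] containing [X]. *)
pose X := (Phi @: Jk)%VS; pose K := (J :&: lker Psi)%VS.
pose W := <<[tuple w i | i < k]>>%VS.
pose Y := (X + (U :\: (W + X)))%VS.
have PhiR : (Phi @: Rk)%VS = U.
  apply/vspaceP => u; apply/memv_imgP/idP => [[r /ffun_vspaceP rR ->]|/wg[r rR ->]].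
    by rewrite lfunE; apply: memv_suml => i _; apply: RU.
  by exists r; [apply/ffun_vspaceP | rewrite lfunE].
have JkRk : (Jk <= Rk)%VS.
  apply/subvP => r /ffun_vspaceP rJ; apply/ffun_vspaceP => i.
  exact: (subvP JR).
(* Relations between minimal generators have all coefficients in [J], so [Phi] has the same kernel
   on [Rk] as on [Jk]; comparing the two ranks gives [\dim U - \dim X]. *)
have kerE : (Rk :&: lker Phi)%VS = (Jk :&: lker Phi)%VS.
  apply/eqP; rewrite eqEsubv; apply/andP; split; last exact: capvS.
  apply/subvP => s.
  rewrite !memv_cap => /andP[/ffun_vspaceP sR sker]; rewrite sker andbT.
  apply/ffun_vspaceP; apply: wfree => //.
  by move: sker; rewrite memv_ker lfunE => /eqP.
have dimUX : (\dim U = \dim X + k * (\dim R - \dim J))%N.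
  have := limg_ker_dim Phi Rk; have := limg_ker_dim Phi Jk.
  rewrite kerE PhiR !dim_ffun_vspace -/X mulnBr.
  have : (k * \dim J <= k * \dim R)%N by rewrite leq_mul2l dimvS ?orbT.
  have ar (a x u j r : nat) : (j <= r -> a + x = j -> a + u = r -> u = x + (r - j))%N.
    by lia.
  exact: ar.
have XU : (X <= U)%VS by rewrite -PhiR limgS.
have WU : (W <= U)%VS by apply/span_subvP => _ /tnthP[i ->]; rewrite tnth_mktuple.
have UJX u a : u \in U -> a \in J -> u *m a \in X.
  move=> /wg[r rR ->] aJ; apply/memv_imgP; exists [ffun i => r i * a].
    by apply/ffun_vspaceP => i; rewrite ffunE RJ.
  rewrite lfunE /= /gen_comb mulmx_suml.
  by apply: eq_bigr => i _; rewrite ffunE mulmxA.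
(* Such a combination yields a relation with coefficients [c i *: e - a i], which therefore lie in
   [J]; then so does [c i *: e], and [e \notin J] forces [c i = 0]. Thus the generators are linearly
   independent modulo [X]. *)
have cW (c : 'I_k -> F) : \sum_i c i *: w i \in X -> forall i, c i = 0.
  move=> /memv_imgP[a /ffun_vspaceP aJ].
  rewrite lfunE /= => wE i; pose s := [ffun i => c i *: e - a i].
  have sR j : s j \in R.
    by rewrite ffunE memvB ?memvZ // (subvP JR).
  have /wfree : gen_comb w s = 0.
    transitivity (gen_comb w [ffun i => c i *: e] - gen_comb w a).
      rewrite -linearB; congr gen_comb; by apply/ffunP => j; rewrite !ffunE.
    rewrite -wE; apply/eqP; rewrite subr_eq0; apply/eqP; apply: eq_bigr => j _.
    by rewrite ffunE -scalemxAr eU.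
  move=> /(_ sR i); rewrite ffunE => siJ.
  have : c i *: e \in J by rewrite -[_ *: _](subrK (a i)) memvD.
  by rewrite rpredZeq (negPf eJ) orbF => /eqP.
have dimW : \dim W = k.
  suff : free [tuple w i | i < k] by rewrite /free size_tuple => /eqP.
  apply/freeP => c c0; apply: cW; rewrite (eq_bigr (fun i => c i *: [tuple w i | i < k]`_i)) ?c0 ?mem0v // => i _.
  by rewrite nth_mktuple.
have WX : (W :&: X)%VS = 0%VS.
  apply/eqP; rewrite -subv0; apply/subvP => u.
  rewrite memv_cap => /andP[/coord_span uE uX].
  pose c i := coord [tuple w i | i < k] i u.
  have {}uE : u = \sum_i c i *: w i.
    by rewrite {1}uE; apply: eq_bigr => i _; rewrite nth_mktuple.
  rewrite uE in uX; have c0 := cW _ uX.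
  by rewrite uE big1 ?mem0v // => i _; rewrite c0 scale0r.
have WXU : (W + X <= U)%VS by rewrite subv_add WU.
have UWY : (W + Y)%VS = U.
  rewrite /Y addvA addvC -[RHS](addv_diff_cap U (W + X)); congr (_ + _)%VS.
  by apply/esym/capv_idPr.
have dimY : (\dim Y + k = \dim U)%N.
  have h1 := dimv_cap_compl U (W + X).
  rewrite (capv_idPr WXU) (dimv_disjoint_sum WX) dimW in h1.
  have h2 := (dimv_add_leqif X (U :\: (W + X))).1.
  have h3 := (dimv_add_leqif W Y).1; rewrite UWY dimW in h3.
  have ar (x d u y : nat) :
    (k + x + d = u -> y <= x + d -> u <= k + y -> y + k = u)%N by lia.
  exact: ar h1 h2 h3.
have KP a : a \in K -> a \in J /\ forall i, w i *m a = 0.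
  rewrite memv_cap memv_ker lfunE => /andP[aJ /eqP a0]; split=> // i.
  by have /ffunP/(_ i) := a0; rewrite !ffunE.
have KJ : (K <= J)%VS by apply: capvSl.
have mK : mul_closed K.
  move=> a b /KP[aJ a0] /KP[bJ _]; rewrite memv_cap RJ ?(subvP JR) //=.
  rewrite memv_ker lfunE; apply/eqP/ffunP => i.
  by rewrite !ffunE mulmxA a0 mul0mx.
exists k, (\dim X), Y, K; split=> //.
- split=> //; apply: contraLR; rewrite -!eqn0Ngt => k0.
  rewrite dimv_eq0 -subv0; apply/subvP => u /wg[r _ ->].
  rewrite memv0 /gen_comb big1 // => i _.
  by have := ltn_ord i; rewrite [X in (_ < X)%N](eqP k0).
(* Rank-nullity for [Psi] on [J]: the kernel is [K], and the image consists of [k]-tuples of vectors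
   of [X]. *)
- have := limg_ker_dim Psi J; rewrite -/K => <-.
  rewrite addnC leq_add2r -dim_ffun_vspace; apply: dimvS.
  apply/subvP => _ /memv_imgP[a aJ ->]; apply/ffun_vspaceP => i.
  by rewrite lfunE ffunE UJX.
split=> //.
- move=> u a uY aK; apply: (subvP (addvSl X _)); apply: UJX; last by case/KP: aK.
  by apply: subvP uY; rewrite -UWY addvSr.
(* An element of [K] kills [W], so if it also kills [Y] it kills [W + Y = U]. *)
- move=> a /KP[aJ a0] aY; apply: fJ => // u; rewrite -UWY.
  case/memv_addP=> v /coord_span -> [y yY ->].
  rewrite mulmxDl (aY y yY) addr0 mulmx_suml big1 // => i _.
  by rewrite nth_mktuple -scalemxAl a0 scaler0.
- move=> x ys xK ysK; set z := lie_comm x ys.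
  have zK : z \in K by apply: lie_comm_mem.
  have [zJ z0] := KP _ zK; apply: fJ => // u /wg[r rR ->].
  rewrite /gen_comb mulmx_suml big1 // => i _.
  have : lie_bracket z (r i) = 0.
    by apply: lJ; rewrite ?(subvP KJ) // => y /ysK; apply: (subvP KJ).
  rewrite /lie_bracket => /eqP; rewrite subr_eq0 => /eqP zr.
  by rewrite -mulmxA -[r i *m z]zr mulmxA z0 mul0mx.
Qed.

(** * Nil algebras *)

Lemma lie_comm_rcons (x : 'M[F]_n.+1) ys y :
  lie_comm x (rcons ys y) = lie_bracket (lie_comm x ys) y.
Proof. by rewrite /lie_comm -cats1 foldl_cat. Qed.

Lemma lie_nilpotent_bracket R m (x : 'M[F]_n.+1) (ys : m.-tuple 'M[F]_n.+1) r :
  lie_nilpotent_index R m.+1 -> x \in R -> {in ys, forall y, y \in R} ->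
  r \in R -> lie_bracket (lie_comm x ys) r = 0.
Proof.
move=> lR xR ysR rR; rewrite -lie_comm_rcons.
apply: (lR x [tuple of rcons ys r]) => // y.
by rewrite mem_rcons inE => /orP[/eqP ->|/ysR].
Qed.

Lemma mul_geometric (z : 'M[F]_n.+1) N : z ^+ N = 0 ->
  (1 - z) * (\sum_(i < N) z ^+ i) = 1.
Proof.
by move=> zN; apply/eqP; rewrite -opprB mulNr -subrX1 zN sub0r opprK.
Qed.

Definition nil R := forall a, a \in R -> exists N, a ^+ N = 0.

(** Adjoining the identity matrix makes [J] the radical of a local algebra of residue degree 1, to
    which [local_step] applies. The first part is its [k]; the others come from [K] acting on
    [Y]. *)
Lemma nil_bound m J U :
  mul_closed J -> nil J -> acts_on J U -> faithful_on J U ->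
  lie_nilpotent_index J m ->
  exists s, [/\ size s = m.+1, sumn s = \dim U & (\dim J <= esum2 s)%N].
Proof.
elim: m J U => [|m IH] J U mJ nJ JU fJ lJ.
  exists [:: \dim U]; split; rewrite /= ?addn0 //.
  (* Index 0 says that [lie_comm x [::]], which is [x] itself, vanishes. *)
  suff -> : J = 0%VS by rewrite dimv0.
  apply/eqP; rewrite -subv0; apply/subvP => x xJ; rewrite memv0; apply/eqP.
  by apply: (lJ x [tuple]).
pose R := (J + <[1%R : 'M[F]_n.+1]>)%VS.
have RP r : r \in R -> exists2 a, a \in J & exists c, r = a + c%:A.
  by case/memv_addP=> a aJ [_ /vlineP[c ->] ->]; exists a => //; exists c.
have JR : (J <= R)%VS by apply: addvSl.
have R1 : 1 \in R by rewrite (subvP (addvSr J _)) // memv_line.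
have J1 : 1 \notin J.
  by apply/negP => /nJ[N] /eqP; rewrite expr1n oner_eq0.
have RJ r a : r \in R -> a \in J -> r * a \in J.
  move=> /RP[b bJ [c ->]] aJ; rewrite mulrDl mulr_algl.
  by rewrite memvD ?memvZ ?mJ.
have mR : mul_closed R.
  move=> r _ rR /RP[b bJ [c ->]]; rewrite mulrDr mulr_algr memvD ?memvZ //.
  by rewrite (subvP JR) ?RJ.
have dimR : (\dim R = \dim J + 1)%N.
  rewrite /R dimv_disjoint_sum ?dim_vline ?oner_eq0 //.
  apply/eqP; rewrite -subv0; apply/subvP => x /memv_capP[xJ /vlineP[c xE]].
  by move: xJ; rewrite xE rpredZeq (negPf J1) orbF => /eqP ->; rewrite scale0r mem0v.
have [] := @local_step R J U 1 m => //.
- by move=> u _; rewrite mulmx1.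
- move=> u r uU /RP[a aJ [c ->]].
  have -> : u *m (a + c%:A) = u *m a + c *: u.
    by rewrite mulmxDr; congr (_ + _); rewrite -[u in RHS]mulmx1 scalemxAr.
  by rewrite memvD ?JU ?memvZ.
(* An element outside [J] is [c *: (1 - z)] with [c != 0] and [z] nilpotent, and a finite geometric
   series inverts it. *)
- move=> r rR; have [a aJ [c rE]] := RP r rR => rJ.
  have c0 : c != 0 by apply: contraNneq rJ => c0; rewrite rE c0 scale0r addr0.
  have [N aN] := nJ _ aJ; pose z := - c^-1 *: a.
  have zR i : z ^+ i \in R.
    by elim: i => // i IHi; rewrite exprS mR // memvZ // (subvP JR).
  have zN : z ^+ N = 0 by rewrite /z exprZn aN scaler0.
  exists (c^-1 *: \sum_(i < N) z ^+ i); first by rewrite memvZ ?memv_suml.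
  rewrite -(mul_geometric zN) -scalerAr scalerAl; congr (_ * _).
  by rewrite rE scalerDr scalerA mulVf // scale1r /z scaleNr opprK addrC.
(* Scalars are central, so bracketing with [a + c%:A] is bracketing with [a]. *)
- move=> x ys r xJ ysJ /RP[a aJ [c ->]].
  have := lie_nilpotent_bracket lJ xJ ysJ aJ; rewrite /lie_bracket => h.
  by rewrite mulrDr mulrDl mulr_algr mulr_algl opprD addrACA h subrr addr0.
move=> k [x [Y [K [[dU _] dY dJ [KJ mK KY fK lK]]]]].
have [s [s1 s2 s3]] := IH K Y mK (fun a aK => nJ a (subvP KJ a aK)) KY fK lK.
exists (k :: s); rewrite /= s1 s2 addnC dY; split=> //.
(* With residue degree 1, [\dim X] equals [\dim Y], so [k * \dim X] is exactly the new term of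
   [esum2 (k :: s)]. *)
rewrite dimR addKn muln1 in dU.
apply: leq_trans dJ _; apply: leq_add => //; rewrite leq_mul2l.
by apply/orP; right; rewrite -(leq_add2r k) dY dU.
Qed.

(** * Idempotents and Fitting's lemma *)

(** The identity [e] may differ from the identity matrix, as it does for proper corners. *)
Definition unital R e :=
  [/\ e \in R, mul_closed R, {in R, forall x, e * x = x} &
      {in R, forall x, x * e = x}].

(* Cayley-Hamilton gives a^N = a^(N+1) g with g a polynomial in a; then
   (a g)^N is the Fitting idempotent of a. *)
Lemma fitting_idempotent R e a :
  unital R e -> a \in R ->
  exists g N, [/\ g \in R, a * g = g * a, (a * g) ^+ N.+1 \in R,
    (a * g) ^+ N.+1 * (a * g) ^+ N.+1 = (a * g) ^+ N.+1 &
    a ^+ N.+1 * (a * g) ^+ N.+1 = a ^+ N.+1].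
Proof.
move=> [eR mR Re' Re] aR.
(* The characteristic polynomial is [q * 'X ^+ N] with [q] nonzero at 0, and [q = h * 'X + c%:P]
   with [c != 0]. Cayley-Hamilton then gives [H * a * a ^+ N = - c *: a ^+ N], whence the choice of
   [G]. *)
have [N [q]] := multiplicity_XsubC (char_poly a) 0.
rewrite monic_neq0 ?char_poly_monic //= subr0 => q0 pE.
elim/poly_ind: q q0 pE => [|h c _]; first by rewrite root0.
rewrite rootE hornerMXaddC mulr0 add0r => c0 pE.
pose H := horner_mx a h; pose G := - c^-1 *: H.
have aH : a * H = H * a by apply: comm_mx_horner.
have aG : a * G = G * a by rewrite /G -scalerAr aH scalerAl.
have GaN : G * a * a ^+ N = a ^+ N.
  have := Cayley_Hamilton a; rewrite pE rmorphM rmorphD rmorphXn rmorphM /=.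
  rewrite horner_mx_X horner_mx_C -/H mulrDl.
  rewrite [X in _ + X](mul_scalar_mx c (a ^+ N)) => /eqP.
  rewrite addr_eq0 => /eqP HaN.
  by rewrite /G -2!scalerAl HaN scalerN scaleNr opprK scalerA mulVf // scale1r.
have eHR : e * H \in R.
  rewrite /H; elim/poly_ind: (h) => [|p d IHp]; first by rewrite rmorph0 mulr0 mem0v.
  rewrite rmorphD rmorphM /= horner_mx_X horner_mx_C mulrDr mulrA.
  apply: memvD; first exact: mR.
  by rewrite [X in X \in _](mul_mx_scalar d e) memvZ.
have eGR : e * G \in R by rewrite -scalerAr memvZ.
have agE : a * (e * G) = G * a by rewrite mulrA Re.
have gaE : e * G * a = G * a by rewrite -mulrA -aG mulrA Re'.
have taN i : (G * a) ^+ i * a ^+ N.+1 = a ^+ N.+1.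
  elim: i => [|i IHi]; first by rewrite mul1r.
  by rewrite exprSr -mulrA exprSr [G * a * _]mulrA GaN -exprSr.
have tR i : (G * a) ^+ i.+1 \in R.
  by elim: i => [|i IHi]; [rewrite expr1 -gaE mR | rewrite exprS mR // -gaE mR].
have tE : (G * a) ^+ N.+1 = a ^+ N.+1 * G ^+ N.+1.
  by rewrite -aG exprMn_comm.
(* The matrix 1 need not lie in [R]: the factor [e] brings the polynomial [G] into [R], and the
   exponent [N.+1] avoids the zeroth power. *)
exists (e * G), N; rewrite agE gaE; split=> //.
  by rewrite {2}tE mulrA taN -tE.
suff -> : GRing.comm (a ^+ N.+1) ((G * a) ^+ N.+1) by exact: taN.
apply: commrX; apply: commr_sym; apply: commrX.
by rewrite /GRing.comm [RHS]mulrA aG.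
Qed.

(** If the Fitting idempotent of [a] is 0, a power of [a] vanishes; if it is [e], then
    [a * (g * (a * g) ^+ N) = e]. *)
Lemma nil_or_invertible R e a : unital R e ->
  (forall f, f \in R -> f * f = f -> f = 0 \/ f = e) -> a \in R ->
  (exists N, a ^+ N.+1 = 0) \/ exists2 t, t \in R & a * t = e /\ t * a = e.
Proof.
move=> uR idR aR; have [eR mR eRl eRr] := uR.
have [g [N [gR ag fR ff af]]] := fitting_idempotent uR aR.
have [f0|fe] := idR _ fR ff; [left; exists N | right].
  by rewrite -af f0 mulr0.
exists (g * (a * g) ^+ N).
  elim: N {fR ff af fe} => [|i IHi]; rewrite ?expr0 ?mulr1 // exprSr [g * (_ * (a * g))]mulrA.
  exact: mR IHi (mR _ _ aR gR).
have ac : GRing.comm a (g * (a * g) ^+ N).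
  by apply: commrM => //; apply/commrX/commrM.
by rewrite -ac mulrA -exprS.
Qed.

Lemma nil_not_invertible R e a y N : unital R e -> a \in R -> y \in R ->
  a ^+ N.+1 = 0 -> y * a = e -> e = 0.
Proof.
move=> [eR mR eRl eRr] aR yR aN ya.
have E i : y ^+ i.+1 * a ^+ i.+1 = e.
  elim: i => // i IHi; rewrite exprSr [a ^+ _]exprS mulrA -(mulrA _ y) ya.
  rewrite -[RHS]IHi -mulrA; congr (_ * _); rewrite eRl //.
  by elim: i {IHi} => // i IHi; rewrite exprS mR.
by rewrite -(E N) aN mulr0.
Qed.

(** Bracketing with [f] multiplies the off-diagonal Peirce components [f * r - f * r * f] and
    [r * f - f * r * f] by -1 and 1. Iterated brackets with [f] vanish, so both components are 0. *)
Lemma idempotent_central R f r m : mul_closed R ->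
  lie_nilpotent_index R m -> f \in R -> f * f = f -> r \in R -> f * r = r * f.
Proof.
move=> mR lR fR ff rR.
have zero (x : 'M[F]_n.+1) (c : F) :
    x \in R -> c != 0 -> x * f - f * x = c *: x -> x = 0.
  move=> xR c0 xf.
  have E i : lie_comm x (nseq i f) = c ^+ i *: x.
    elim: i => [|i IHi]; first by rewrite scale1r.
    rewrite -[i.+1]addn1 nseqD cats1 lie_comm_rcons IHi /lie_bracket.
    by rewrite -scalerAr -scalerAl -scalerBr xf scalerA addn1 exprSr.
  apply/eqP; have /eqP : lie_comm x (nseq m f) = 0.
    apply: (lR x [tuple of nseq m f]) => // y.
    by rewrite mem_nseq => /andP[_ /eqP ->].
  by rewrite E scaler_eq0 expf_eq0 (negPf c0) andbF.
have fRR x : x \in R -> f * x \in R by apply: mR.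
have Rf x : x \in R -> x * f \in R by move=> xR; apply: mR.
have h1 : f * r - f * r * f = 0.
  apply: (zero _ (- 1)); rewrite ?oppr_eq0 ?oner_eq0 //.
    by rewrite memvB ?Rf ?fRR.
  rewrite mulrBl mulrBr -(mulrA _ f f) ff subrr !mulrA ff sub0r.
  by rewrite scaleN1r.
have h2 : r * f - f * r * f = 0.
  apply: (zero _ 1); rewrite ?oner_eq0 //.
    by rewrite memvB ?Rf ?fRR.
  rewrite mulrBl mulrBr -!(mulrA _ f f) ff !mulrA ff subrr subr0.
  by rewrite scale1r.
by rewrite (subr0_eq h1) (subr0_eq h2).
Qed.

(** * Fixed spaces of idempotents, and the local case *)

(** For an idempotent [e] this is the row space of [e], the natural module of an algebra with
    identity [e]. *)
Definition fixv e : {vspace 'rV[F]_n.+1} := fixedSpace (linfun (mulmxr e)).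

Lemma fixvP e u : reflect (u *m e = u) (u \in fixv e).
Proof. by apply: (iffP fixedSpaceP); rewrite lfunE. Qed.

(** The rows of [e] are fixed by [e], and the rows of [a = e * a] are their images under [a]. *)
Lemma fixv_faithful R e : unital R e -> faithful_on R (fixv e).
Proof.
move=> [eR _ eRl eRr] a aR a0; rewrite -(eRl a aR); apply/row_matrixP => i.
rewrite row0 [e * a]/(e *m a) row_mul; apply: a0; apply/fixvP.
by rewrite -row_mul [e *m e]eRl.
Qed.

Lemma fixv_gt0 R e : unital R e -> e != 0 -> (0 < \dim (fixv e))%N.
Proof.
move=> uR; apply: contra_neqT; rewrite -eqn0Ngt dimv_eq0 => /eqP f0.
have [eR _ _ _] := uR; apply: (fixv_faithful uR eR) => u.
by rewrite f0 memv0 => /eqP ->; rewrite mul0mx.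
Qed.

Lemma fixv_split f g : f * f = f -> g * g = g -> f * g = 0 -> g * f = 0 ->
  \dim (fixv (f + g)) = (\dim (fixv f) + \dim (fixv g))%N.
Proof.
move=> ff gg fg gf; rewrite -dimv_disjoint_sum; last first.
  apply/eqP; rewrite -subv0; apply/subvP => u /memv_capP[/fixvP uf /fixvP ug].
  by rewrite memv0 -uf -ug -mulmxA [g *m f]gf mulmx0.
congr (\dim _); apply/vspaceP => u; apply/fixvP/memv_addP => [ufg|].
  exists (u *m f); first by apply/fixvP; rewrite -mulmxA [f *m f]ff.
  exists (u *m g); first by apply/fixvP; rewrite -mulmxA [g *m g]gg.
  by rewrite -mulmxDr.
move=> [v /fixvP vf [w /fixvP wg ->]].
have vg : v *m g = 0 by rewrite -vf -mulmxA [f *m g]fg mulmx0.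
have wf : w *m f = 0 by rewrite -wg -mulmxA [g *m f]gf mulmx0.
by rewrite mulmxDl !mulmxDr vf wg vg wf addr0 add0r.
Qed.

(** The nilpotent elements form the radical [J]; [local_step] splits off one part, and [nil_bound]
    treats the remaining nil algebra [K]. *)
Lemma local_bound m R e :
  unital R e -> e != 0 -> lie_nilpotent_index R m.+1 ->
  (forall f, f \in R -> f * f = f -> f = 0 \/ f = e) ->
  exists s, [/\ size s = m.+2, sumn s = \dim (fixv e) &
    (\dim R <= (esum2 s).+1)%N].
Proof.
move=> uR e0 lR idR; have [eR mR eRl eRr] := uR.
pose P a := a \in R /\ exists N, a ^+ N.+1 = 0.
have inv a : a \in R -> ~ P a -> exists2 t, t \in R & a * t = e /\ t * a = e.
  move=> aR nPa; have [[N aN]|//] := nil_or_invertible uR idR aR.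
  by case: nPa; split=> //; exists N.
have Pinv a y : P a -> y \in R -> y * a = e -> False.
  move=> [aR [N aN]] yR ya; case/eqP: e0.
  exact: (nil_not_invertible uR aR yR aN ya).
(* Otherwise [r * a] has an inverse [t], and [t * r] is a left inverse of the nilpotent [a]. *)
have PM r a : r \in R -> P a -> P (r * a).
  move=> rR Pa; have [aR _] := Pa; apply: NNPP => /(inv _ (mR _ _ rR aR))[t tR [_]].
  by rewrite mulrA; apply: Pinv => //; apply: mR.
have P0 : P 0 by split; [apply: mem0v | exists 0%N].
(* If [t] inverted the combination, then [t * b = e * (1 - z)] with [z = t * (c *: a)] nilpotent;
   the geometric series in [z] would then make [b] left invertible. *)
have PL c a b : P a -> P b -> P (c *: a + b).
  move=> Pa Pb; have [aR _] := Pa; have [bR _] := Pb.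
  have caE : c *: a = (c *: e) * a by rewrite -scalerAl eRl.
  apply: NNPP => /(inv _ (memvD (memvZ c aR) bR))[t tR [_ tab]].
  have Pz : P (t * (c *: a)) by rewrite caE; exact: PM tR (PM _ _ (memvZ c eR) Pa).
  have tbE : t * b = e * (1 - t * (c *: a)).
    by rewrite mulrBr mulr1 mulrA [e * t]eRl // -tab mulrDr addrC addKr.
  have [zR [N zN]] := Pz; set z := t * (c *: a) in Pz zR zN tbE.
  have sR : e * (\sum_(i < N.+1) z ^+ i) \in R.
    rewrite mulr_sumr memv_suml // => i _; case: i => i _ /=.
    by elim: i => [|i IHi]; rewrite ?expr0 ?mulr1 // exprSr mulrA mR.
  apply: (Pinv b (e * (\sum_(i < N.+1) z ^+ i) * t) Pb); first exact: mR.
  rewrite -(mulrA _ t b) tbE mulrA (eRr _ sR) -mulrA.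
  by rewrite [X in e * X](mulmx1C (mul_geometric zN)) mulr1.
have [J JP] := vspace_of_pred P0 PL.
have JR : (J <= R)%VS by apply/subvP => a /JP[].
have eJ : e \notin J by apply/negP => /JP Pe; apply: (Pinv e e); rewrite ?eRl.
have [] := @local_step R J (fixv e) e m => //.
- by move=> u /fixvP.
- by move=> u a /fixvP uf aR; apply/fixvP; rewrite -mulmxA [a *m e]eRr.
- by move=> r a rR /JP Pa; apply/JP; apply: PM.
- move=> r rR rJ; have [|t tR [rt _]] := inv r rR; last by exists t.
  by move=> /JP; apply/negP.
- by move=> a aJ; apply: (fixv_faithful uR); apply: (subvP JR).
- move=> x ys r xJ ysJ rR; apply: (lie_nilpotent_bracket lR) => //.
    exact: (subvP JR).
  by move=> y /ysJ; apply: (subvP JR).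
move=> k [x [Y [K [[dU kU] dY dJ [KJ mK KY fK lK]]]]].
have nK : nil K by move=> a /(subvP KJ) /JP[_ [N aN]]; exists N.+1.
have [s [s1 s2 s3]] := nil_bound mK nK KY fK lK.
exists (k :: s); rewrite /= s1 s2 addnC dY; split=> //.
have dJR : (\dim J < \dim R)%N.
  rewrite ltn_neqAle dimvS // andbT; apply: contraNneq eJ => dE.
  suff -> : J = R by [].
  by apply/eqP; rewrite eqEdim JR dE /=.
have k0 := kU (fixv_gt0 uR e0).
move: dU dY dJ s3 dJR.
move: (\dim R) (\dim J) (\dim K) (\dim Y) (\dim (fixv e)) (esum2 s).
move=> dR dJ dK dY dU E dUE dYE dJE dKE dJR.
(* Here d + 1 is the residue degree; its excess d over 1 is absorbed by k * (k * d). *)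
have [d dE] : exists d, dR = (dJ + d.+1)%N by exists (dR - dJ.+1)%N; lia.
have {}dUE : dU = (x + k * d.+1)%N by rewrite dUE dE; congr (_ + k * _)%N; lia.
have dYx : dY = (x + k * d)%N by nia.
subst dY; nia.
Qed.

(** * Splitting along central idempotents *)

Lemma unital_corner R e f m : unital R e -> lie_nilpotent_index R m ->
  f \in R -> f * f = f -> exists R1, [/\ unital R1 f, (R1 <= R)%VS &
    {in R, forall r, f * r \in R1}].
Proof.
move=> [eR mR eRl eRr] lR fR ff.
have fc r : r \in R -> f * r = r * f by apply: idempotent_central lR fR ff.
have fM r : linfun (mulmx f) r = f * r by rewrite lfunE.
(* Since [f] is central in [R], left multiplication by [f] maps [R] onto an algebra with identity
   [f]. *)
exists (linfun (mulmx f) @: R)%VS; split; last 1 first.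
- by move=> r rR; rewrite -fM memv_img.
- split; first by rewrite -{1}ff -fM memv_img.
  + move=> _ _ /memv_imgP[r rR ->] /memv_imgP[s sR ->].
    rewrite [X in X * _]fM -mulrA -fM memv_img // mR // fM; exact: mR.
  + by move=> _ /memv_imgP[r rR ->]; rewrite fM mulrA ff.
  + by move=> _ /memv_imgP[r rR ->]; rewrite fM -fc ?mulrA ?ff // mR.
- by apply/subvP => _ /memv_imgP[r rR ->]; rewrite fM; exact: mR.
Qed.

(** Induction on the dimension of the fixed space: a nontrivial idempotent splits [R] into two
    corners acting on smaller nonzero spaces. *)
Lemma unital_bound m R e :
  unital R e -> e != 0 -> lie_nilpotent_index R m.+1 ->
  exists s, [/\ size s = m.+2, sumn s = \dim (fixv e) &
    (\dim R <= (esum2 s).+1)%N].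
Proof.
have [d] := ubnP (\dim (fixv e)); elim: d R e => // d IH R e led uR e0 lR.
have [eR mR eRl eRr] := uR.
have [[f [fR ff f0 fe]]|nof] :=
  classic (exists f, [/\ f \in R, f * f = f, f != 0 & f != e]); last first.
  apply: local_bound => // f fR ff; have [->|f0] := eqVneq f 0; first by left.
  have [->|fe] := eqVneq f e; first by right.
  by case: nof; exists f.
pose g := e - f.
have gR : g \in R by rewrite memvB.
have fg : f * g = 0 by rewrite mulrBr eRr // ff subrr.
have gf : g * f = 0 by rewrite mulrBl eRl // ff subrr.
have gg : g * g = g by rewrite {1}/g mulrBl fg subr0 eRl.
have g0 : g != 0 by rewrite subr_eq0 eq_sym.
have efg : e = f + g by rewrite addrC subrK.
have [R1 [u1 R1R fR1]] := unital_corner uR lR fR ff.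
have [R2 [u2 R2R gR2]] := unital_corner uR lR gR gg.
have lsub S : (S <= R)%VS -> lie_nilpotent_index S m.+1.
  move=> SR x ys xS ysS; apply: lR; first exact: (subvP SR).
  by move=> y /ysS; apply: (subvP SR).
have dE := fixv_split ff gg fg gf; rewrite -efg in dE.
have d1 := fixv_gt0 u1 f0; have d2 := fixv_gt0 u2 g0.
rewrite ltnS dE in led.
have [|s [s1 s2 s3]] := IH R1 f _ u1 f0 (lsub _ R1R).
  by apply: leq_trans led; rewrite -addn1 leq_add2l.
have [|t [t1 t2 t3]] := IH R2 g _ u2 g0 (lsub _ R2R).
  by apply: leq_trans led; rewrite -add1n leq_add2r.
(* The strict inequality merges the two [.+1] of the corner bounds into one. *)
have [||r [r1 r2 r3]] := esum2_superadd s1 t1; rewrite ?s2 ?t2 //.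
exists r; split; rewrite // ?dE -?s2 -?t2 //.
have RR : (R <= R1 + R2)%VS.
  apply/subvP => a aR; rewrite -(eRl a aR) efg mulrDl.
  by rewrite memv_add ?fR1 ?gR2.
apply: leq_trans (dimvS RR) _.
apply: leq_trans (dimv_add_leqif R1 R2).1 _.
by apply: leq_trans (leq_add s3 t3) _; rewrite addSn addnS !ltnS.
Qed.

End LocalAlgebra.

Theorem mainTheorem1 (F : fieldType) (m n : nat) (R : {vspace 'M[F]_n}) :
  (0 < m)%N -> (0 < n)%N ->
  is_subalgebra R ->
  lie_nilpotent_index (A := 'M[F]_n) R m ->
  (\dim R <= M m.+1 n)%N.
Proof.
case: m n R => [//|m] [//|n] R _ _ [R1 mR] lR.
have uR : unital R 1.
  by split=> // a _; rewrite ?mul1r ?mulr1.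
have [s [s1 s2 s3]] := unital_bound uR (oner_neq0 _) lR.
(* The identity matrix fixes every row vector, so the parts sum to the full matrix size. *)
have sn : sumn s = n.+1.
  rewrite s2; have -> : fixv (1 : 'M[F]_n.+1) = fullv.
    by apply/vspaceP => u; rewrite memvf; apply/fixvP; rewrite mulmx1.
  by rewrite dimvf /dim /= mul1n.
by apply: leq_trans s3 _; have := @esum2_le_M s; rewrite s1 sn addn1; apply.
Qed.
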